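(* Let $n,s\ge 0$ be integers and let $r,k\in\mathbb{Z}$. Then, as polynomials in $x$, $$A_{n}^{(r,k)}(x)=\sum_{m=0}^{n}\left\{(-1)^{m}\sum_{l=0}^{n-m}\binom{n}{l}S_{1}(n-l,m)A_{l}^{(r+s,k)}(s)\right\}B_{m}^{(s)}(x).$$
   Context: All generating functions are formal power series in $t$. For $k\in\mathbb{Z}$, put $\mathrm{Lif}_k(t)=\sum_{n\ge 0}\frac{t^n}{n!(n+1)^k}$. For $r,k\in\mathbb{Z}$, the polynomials $A_n^{(r,k)}(x)\in\mathbb{C}[x]$ are defined by $$\left(\frac{t}{\log(1+t)}\right)^{r}\frac{\mathrm{Lif}_k(\log(1+t))}{(1+t)^{x}}=\sum_{n\ge 0}A_n^{(r,k)}(x)\frac{t^n}{n!}.$$ The Bernoulli polynomials of order $s$ are defined by $\left(\frac{t}{e^t-1}\right)^{s}e^{xt}=\sum_{n\ge 0}B_n^{(s)}(x)\frac{t^n}{n!}$. $S_1(n,m)$ is the (signed) Stirling number of the first kind: $x(x-1)\cdots(x-n+1)=\sum_{m=0}^n S_1(n,m)x^m$ (with $S_1(0,0)=1$). *)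

(* Defs.v *)
From HB Require Import structures.
From mathcomp Require Import all_boot all_order all_algebra.
From mathcomp Require Import boolp reals.
From mathcomp Require Import complex.

Set Implicit Arguments.
Unset Strict Implicit.
Unset Printing Implicit Defensive.

Import GRing.Theory.
Local Open Scope ring_scope.

(** * The ring of formal power series A[[t]] *)

Record fps (A : Type) : Type := Fps { fps_coef : nat -> A }.

Notation "f `[ n ]" := (fps_coef f n)
  (at level 2, left associativity, format "f `[ n ]") : ring_scope.

Lemma fpsP (A : Type) (f g : fps A) : (forall n, f`[n] = g`[n]) <-> f = g.
Proof.
split=> [eqfg|-> //]; case: f g eqfg => [f] [g] /= eqfg.
by congr Fps; apply/funext.
Qed.

HB.instance Definition _ (A : Type) := gen_eqMixin (fps A).
HB.instance Definition _ (A : Type) := gen_choiceMixin (fps A).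

Section FpsZmodule.
Variable A : zmodType.
Implicit Types f g h : fps A.

Definition fps_zero : fps A := Fps (fun=> 0).
Definition fps_add f g : fps A := Fps (fun n => f`[n] + g`[n]).
Definition fps_opp f : fps A := Fps (fun n => - f`[n]).

Fact fps_addA : associative fps_add.
Proof. by move=> f g h; apply/fpsP => n /=; rewrite addrA. Qed.
Fact fps_addC : commutative fps_add.
Proof. by move=> f g; apply/fpsP => n /=; rewrite addrC. Qed.
Fact fps_add0 : left_id fps_zero fps_add.
Proof. by move=> f; apply/fpsP => n /=; rewrite add0r. Qed.
Fact fps_addN : left_inverse fps_zero fps_opp fps_add.
Proof. by move=> f; apply/fpsP => n /=; rewrite addNr. Qed.

HB.instance Definition _ :=
  GRing.isZmodule.Build (fps A) fps_addA fps_addC fps_add0 fps_addN.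

End FpsZmodule.

Section FpsRing.
Variable A : comNzRingType.
Implicit Types f g h : fps A.

Definition fps_one : fps A := Fps (fun n => (n == 0)%:R).
Definition fps_mul f g : fps A :=
  Fps (fun n => \sum_(i < n.+1) f`[i] * g`[n - i]).

Let fps_mulE f g n :
  (fps_mul f g)`[n] = \sum_(i < n.+1) f`[i] * g`[n - i].
Proof. by []. Qed.

Let trunc N f : {poly A} := \poly_(i < N.+1) f`[i].

Let coef_trunc N f n : (n <= N)%N -> (trunc N f)`_n = f`[n].
Proof. by move=> le_nN; rewrite coef_poly ltnS le_nN. Qed.

Let coef_mul_trunc N f g n :
  (n <= N)%N -> (fps_mul f g)`[n] = (trunc N f * trunc N g)`_n.
Proof.
move=> le_nN; rewrite coefM /=; apply: eq_bigr => i _.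
have le_in : (i <= n)%N by rewrite -ltnS.
by rewrite !coef_trunc ?(leq_trans _ le_nN) ?leq_subr.
Qed.

Fact fps_mulC : commutative fps_mul.
Proof.
by move=> f g; apply/fpsP => n; rewrite !(@coef_mul_trunc n) // mulrC.
Qed.

Fact fps_mulA : associative fps_mul.
Proof.
move=> f g h; apply/fpsP => n.
transitivity (trunc n f * (trunc n g * trunc n h))`_n.
  rewrite coefM fps_mulE; apply: eq_bigr => i _.
  have le_in : (i <= n)%N by rewrite -ltnS.
  by rewrite coef_trunc // (@coef_mul_trunc n) ?leq_subr.
rewrite mulrA coefM fps_mulE; apply: eq_bigr => i _.
have le_in : (i <= n)%N by rewrite -ltnS.
by rewrite coef_trunc ?leq_subr // -(@coef_mul_trunc n).
Qed.

Fact fps_mul1 : left_id fps_one fps_mul.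
Proof.
move=> f; apply/fpsP => n /=; rewrite big_ord_recl /= subn0 mul1r big1 ?addr0 //.
by move=> i _; rewrite mul0r.
Qed.

Fact fps_mulDl : left_distributive fps_mul (@fps_add A).
Proof.
move=> f g h; apply/fpsP => n /=; rewrite -big_split.
by apply: eq_bigr => i _; rewrite mulrDl.
Qed.

Fact fps_one_neq0 : fps_one != 0.
Proof.
by apply/eqP => /fpsP /(_ 0); apply/eqP; rewrite /= oner_neq0.
Qed.

HB.instance Definition _ := GRing.Zmodule_isComNzRing.Build (fps A)
  fps_mulA fps_mulC fps_mul1 fps_mulDl fps_one_neq0.

Lemma coef_fps0 n : (0 : fps A)`[n] = 0. Proof. by []. Qed.
Lemma coef_fpsD f g n : (f + g)`[n] = f`[n] + g`[n]. Proof. by []. Qed.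
Lemma coef_fpsN f n : (- f)`[n] = - f`[n]. Proof. by []. Qed.
Lemma coef_fps1 n : (1 : fps A)`[n] = (n == 0)%:R. Proof. by []. Qed.
Lemma coef_fpsM f g n : (f * g)`[n] = \sum_(i < n.+1) f`[i] * g`[n - i].
Proof. by []. Qed.

Definition fps_t : fps A := Fps (fun n => (n == 1)%:R).

(* The quotient g / t, meant for series g with zero constant coefficient. *)
Definition fps_divt g : fps A := Fps (fun n => g`[n.+1]).

Lemma fps_divtK g : g`[0] = 0 -> fps_t * fps_divt g = g.
Proof.
move=> g0; apply/fpsP => -[|n]; rewrite coef_fpsM.
  by rewrite big_ord1 mul0r g0.
rewrite !big_ord_recl /= mul0r add0r mul1r big1 ?addr0 => [|i _].
  by rewrite /bump /= add1n subSS subn0.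
by rewrite mul0r.
Qed.

(* The composite f(g(t)), meant for series g with zero constant coefficient,
   so that (g ^+ i)`[n] = 0 for i > n. *)
Definition fps_comp f g : fps A :=
  Fps (fun n => \sum_(i < n.+1) f`[i] * (g ^+ i)`[n]).

End FpsRing.

Section FpsUnitRing.
Variable A : comUnitRingType.
Implicit Types f g h : fps A.

Definition fps_unit : pred (fps A) := fun f => f`[0] \is a GRing.unit.

(* The first n coefficients of f^-1. *)
Fixpoint fps_inv_seq f n : seq A :=
  if n is m.+1 then
    let s := fps_inv_seq f m in
    rcons s (f`[0]^-1 * ((m == 0)%:R - \sum_(i < m) f`[i.+1] * s`_(m - i.+1)))
  else [::].

Definition fps_inv f : fps A :=
  if f \in fps_unit then Fps (fun n => (fps_inv_seq f n.+1)`_n) else f.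

Let size_inv_seq f n : size (fps_inv_seq f n) = n.
Proof. by elim: n => //= n IHn; rewrite size_rcons IHn. Qed.

Let nth_inv_seq f n i : (i < n)%N ->
  (fps_inv_seq f n)`_i = (fps_inv_seq f i.+1)`_i.
Proof.
elim: n => // n IHn; rewrite ltnS leq_eqVlt => /orP[/eqP-> //|lt_in].
by rewrite [in LHS]/= nth_rcons size_inv_seq lt_in IHn.
Qed.

Fact fps_mulVr : {in fps_unit, left_inverse 1 fps_inv *%R}.
Proof.
move=> f Uf; rewrite mulrC; apply/fpsP => n; rewrite coef_fpsM /fps_inv Uf.
rewrite big_ord_recl subn0 [X in _ * X]/= nth_rcons size_inv_seq ltnn eqxx.
rewrite mulrA divrr // mul1r [X in _ + X](_ : _ =
    \sum_(i < n) f`[i.+1] * (fps_inv_seq f n)`_(n - i.+1)) ?subrK //.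
apply: eq_bigr => i _; rewrite [in RHS]nth_inv_seq //.
by rewrite ltn_subrL /= (leq_ltn_trans _ (ltn_ord i)).
Qed.

Fact fps_unitPl f g : g * f = 1 -> fps_unit f.
Proof.
move/fpsP/(_ 0); rewrite coef_fpsM big_ord1 /= => gf1.
by apply/unitrPr; exists g`[0]; rewrite mulrC.
Qed.

Fact fps_inv_out : {in [predC fps_unit], fps_inv =1 id}.
Proof. by move=> f; rewrite inE /fps_inv /= => /negbTE->. Qed.

HB.instance Definition _ := GRing.ComNzRing_hasMulInverse.Build (fps A)
  fps_mulVr fps_unitPl fps_inv_out.

Lemma unit_fpsE f : (f \is a GRing.unit) = (f`[0] \is a GRing.unit).
Proof. by []. Qed.

(** * Classical series *)

(* These are meant for rings A in which every positive integer is invertible,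
   such as {poly C} for a field C of characteristic 0. *)

(* log (1 + t) *)
Definition log1t : fps A :=
  Fps (fun n => if n is m.+1 then (-1) ^+ m / m.+1%:R else 0).

(* exp (x t) *)
Definition expxt (x : A) : fps A := Fps (fun n => x ^+ n / n`!%:R).

(* (1 + t) ^ x, whose coefficients are the generalized binomials 'C(x, n) *)
Definition onetX (x : A) : fps A :=
  Fps (fun n => (\prod_(i < n) (x - i%:R)) / n`!%:R).

Definition Lif (k : int) : fps A :=
  Fps (fun n => (n`!%:R * n.+1%:R ^ k)^-1).

(* t / log (1 + t) *)
Definition t_over_log : fps A := (fps_divt log1t)^-1.

(* t / (exp t - 1) *)
Definition t_over_expB1 : fps A := (fps_divt (expxt 1 - 1))^-1.

End FpsUnitRing.

Arguments log1t {A}.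
Arguments Lif {A}.
Arguments t_over_log {A}.
Arguments t_over_expB1 {A}.

(** * The polynomials A_n^(r,k)(x) and B_n^(s)(x), as elements of F[x] *)

Section Polynomials.
Variable F : fieldType.

Definition polyA (n : nat) (r k : int) : {poly F} :=
  n`!%:R *
  (t_over_log ^ r * (fps_comp (Lif k) log1t / onetX 'X))`[n].

Definition polyB (n s : nat) : {poly F} :=
  n`!%:R * (t_over_expB1 ^+ s * expxt 'X)`[n].

End Polynomials.

(* Signed Stirling numbers of the first kind. *)
Definition stirling1 (n m : nat) : int :=
  (\prod_(i < n) ('X - i%:R) : {poly int})`_m.

(* Main.v *)
(* With L = log (1 + t), the expansion t^s exp (x t) / (exp t - 1)^s =
   sum_m B_m^(s)(x) t^m / m! evaluated at - L in place of t equals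
   (L (1 + t) / t)^s (1 + t)^(- x), so that the generating series of the
   A_n^(r,k)(x) factors as
     sum_m B_m^(s)(x) (- L)^m / m! * (t / L)^(r + s) Lif_k(L) (1 + t)^(- s).
   The last three factors generate the A_l^(r+s,k)(s), and L^m / m! generates
   the Stirling numbers S_1(j, m); compare the coefficients of t^n. *)

Require Import Defs.
From HB Require Import structures.
From mathcomp Require Import all_boot all_order all_algebra.
From mathcomp Require Import reals.
From mathcomp Require Import complex.
From mathcomp Require Import ring.

Set Implicit Arguments.
Unset Strict Implicit.
Unset Printing Implicit Defensive.

Import GRing.Theory.
Local Open Scope ring_scope.

(** * Substitution into a power series of a series without constant term *)

Lemma fps_expr_lt (A : comNzRingType) (g : fps A) m n :
  g`[0] = 0 -> (n < m)%N -> (g ^+ m)`[n] = 0.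
Proof.
move=> g0; elim: m n => // m IHm n; rewrite ltnS => le_nm.
rewrite exprS coef_fpsM big_ord_recl g0 mul0r add0r big1 // => i _.
rewrite lift0 IHm ?mulr0 // (leq_trans _ le_nm) //.
by rewrite ltn_subrL /= (leq_ltn_trans _ (ltn_ord i)).
Qed.

(** Raising the cut-off of the [j]-th coefficient of the composite from [j] to [n] adds only zeros,
    since [g ^+ i] is divisible by [t^i]. *)
Lemma fps_comp_mulE (A : comNzRingType) (f g h : fps A) n :
  g`[0] = 0 ->
  (fps_comp f g * h)`[n] = \sum_(i < n.+1) f`[i] * (g ^+ i * h)`[n].
Proof.
move=> g0; rewrite coef_fpsM.
under [RHS]eq_bigr => i _ do rewrite coef_fpsM mulr_sumr.
rewrite exchange_big; apply: eq_bigr => j _ /=.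
have le_jn : (j.+1 <= n.+1)%N by [].
rewrite (big_ord_widen n.+1 (fun i => f`[i] * (g ^+ i)`[j]) le_jn) mulr_suml.
rewrite [RHS](bigID (fun i : 'I_n.+1 => (i < j.+1)%N)) /= [X in _ = _ + X]big1.
  by rewrite addr0; apply: eq_bigr => i _; rewrite mulrA.
by move=> i; rewrite -leqNgt => /(fps_expr_lt g0) ->; rewrite mul0r mulr0.
Qed.

(** The cut-off in [fps_comp] moves with the coefficient; a common bound lets different coefficients
    be compared term by term. *)
Lemma fps_compE (A : comNzRingType) (f g : fps A) m n :
  g`[0] = 0 -> (n < m)%N ->
  (fps_comp f g)`[n] = \sum_(i < m) f`[i] * (g ^+ i)`[n].
Proof.
move=> g0 lt_nm; rewrite /= (big_ord_widen m (fun i => f`[i] * (g ^+ i)`[n]) lt_nm).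
rewrite [RHS](bigID (fun i : 'I_m => (i < n.+1)%N)) /= [X in _ = _ + X]big1 ?addr0 //.
by move=> i; rewrite -leqNgt => /(fps_expr_lt g0) ->; rewrite mulr0.
Qed.

Section Composition.
Variables (A : comNzRingType) (g : fps A).
Hypothesis g0 : g`[0] = 0.

Lemma fps_comp1 : fps_comp 1 g = 1.
Proof.
apply/fpsP => n /=; rewrite big_ord_recl /= mul1r big1 ?addr0 // => i _.
by rewrite mul0r.
Qed.

Lemma fps_compD f h : fps_comp (f + h) g = fps_comp f g + fps_comp h g.
Proof.
apply/fpsP => n /=; rewrite -big_split.
by apply: eq_bigr => i _; rewrite mulrDl.
Qed.

Lemma fps_compN f : fps_comp (- f) g = - fps_comp f g.
Proof.
apply/fpsP => n /=; rewrite -sumrN.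
by apply: eq_bigr => i _; rewrite mulNr.
Qed.

Lemma fps_comp_t : fps_comp (fps_t A) g = g.
Proof.
(* The bound [n.+2] ensures that the term of index 1 is present even when [n] is 0. *)
apply/fpsP => n; rewrite (@fps_compE _ _ _ n.+2) //= !big_ord_recl /=.
by rewrite mul0r add0r mul1r expr1 big1 ?addr0 // => i _; rewrite mul0r.
Qed.

(** Both coefficients sum the same terms [F i j], over [i + j <= n] on the left and over the full
    square on the right; the extra pairs vanish because [g ^+ (i + j)] has no term below
    [t^(i + j)]. *)
Lemma fps_compM f h : fps_comp (f * h) g = fps_comp f g * fps_comp h g.
Proof.
apply/fpsP => n; rewrite fps_comp_mulE //.
under [RHS]eq_bigr => i _ do rewrite [g ^+ i * _]mulrC fps_comp_mulE // mulr_sumr.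
pose F i j := f`[i] * h`[j] * (g ^+ (i + j))`[n].
transitivity (\sum_(k < n.+1) \sum_(i < n.+1 | (i <= k)%N) F i (k - i)%N).
  apply: eq_bigr => k _; rewrite coef_fpsM.
  rewrite (big_ord_widen n.+1 (fun i => f`[i] * h`[k - i])) // mulr_suml.
  by apply: eq_big => // i; rewrite ltnS /F => le_ik; rewrite subnKC.
transitivity (\sum_(i < n.+1) \sum_(j < n.+1) F i j); last first.
  apply: eq_bigr => i _; apply: eq_bigr => j _.
  by rewrite /F -exprD addnC mulrA.
rewrite (exchange_big_dep xpredT) //=; apply: eq_bigr => i _.
have le_in : (i <= n)%N by rewrite -ltnS.
rewrite -(big_mkord (fun k => i <= k)%N (fun k => F i (k - i)%N)) /=.
rewrite -[RHS](big_mkord xpredT (F i)) (big_cat_nat (n := i)) //=; last exact: ltnW.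
rewrite big_nat_cond big1 ?add0r => [|k /andP[/andP[_ lt_ki]]]; last first.
  by rewrite leqNgt lt_ki.
(* The index becomes [j = k - i], and the right-hand sum is split after [j = n - i]. *)
rewrite -{1}[i : nat]add0n big_addn [RHS](big_cat_nat (n := (n.+1 - i)%N)) ?leq_subr //=.
rewrite [X in _ = _ + X]big_nat_cond [X in _ = _ + X]big1 ?addr0; last first.
  move=> j /andP[/andP[le_j _] _].
  by rewrite /F fps_expr_lt ?mulr0 // -leq_subLR.
by apply: eq_big => k; rewrite ?leq_addl // addnK.
Qed.

Lemma fps_compX f m : fps_comp (f ^+ m) g = fps_comp f g ^+ m.
Proof.
elim: m => [|m IHm]; first by rewrite !expr0 fps_comp1.
by rewrite !exprS fps_compM IHm.
Qed.

End Composition.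

(** * Coefficientwise images under a ring morphism *)

Section Map.
Variables (A B : comNzRingType) (phi : {rmorphism A -> B}).

Definition fps_map (f : fps A) : fps B := Fps (fun n => phi f`[n]).

Fact fps_map_is_zmod_morphism : zmod_morphism fps_map.
Proof. by move=> f g; apply/fpsP => n /=; rewrite raddfB. Qed.

Fact fps_map_is_monoid_morphism : monoid_morphism fps_map.
Proof.
split=> [|f g]; apply/fpsP => n /=; first by rewrite rmorph_nat.
by rewrite rmorph_sum; apply: eq_bigr => i _; rewrite rmorphM.
Qed.

HB.instance Definition _ :=
  GRing.isZmodMorphism.Build (fps A) (fps B) fps_map fps_map_is_zmod_morphism.
HB.instance Definition _ :=
  GRing.isMonoidMorphism.Build (fps A) (fps B) fps_map fps_map_is_monoid_morphism.

Lemma fps_map_comp f g :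
  fps_map (fps_comp f g) = fps_comp (fps_map f) (fps_map g).
Proof.
apply/fpsP => n /=; rewrite rmorph_sum; apply: eq_bigr => i _.
by rewrite rmorphM -rmorphXn.
Qed.

End Map.

(** * Multiplication by [t], the operator t d/dt, and signs *)

Lemma coef_fpsMn (A : zmodType) (f : fps A) m n : (f *+ m)`[n] = f`[n] *+ m.
Proof. by elim: m => // m IHm; rewrite !mulrS -IHm. Qed.

Lemma coef_fps_tM (A : comNzRingType) (f : fps A) n :
  (fps_t A * f)`[n] = if n is m.+1 then f`[m] else 0.
Proof.
case: n => [|n]; rewrite coef_fpsM !big_ord_recl /= mul0r add0r ?big_ord0 //.
by rewrite mul1r subn1 big1 ?addr0 // => i _; rewrite mul0r.
Qed.

(** This stands in for division by [t], which is not a unit. *)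
Lemma fps_t_inj (A : comNzRingType) (f g : fps A) :
  fps_t A * f = fps_t A * g -> f = g.
Proof.
by move/fpsP => tftg; apply/fpsP => n; have := tftg n.+1; rewrite !coef_fps_tM.
Qed.

(* The derivation t d/dt. *)
Definition fps_theta (A : comNzRingType) (f : fps A) : fps A :=
  Fps (fun n => f`[n] *+ n).

Lemma fps_thetaM (A : comNzRingType) (f g : fps A) :
  fps_theta (f * g) = fps_theta f * g + f * fps_theta g.
Proof.
apply/fpsP => n; rewrite coef_fpsD !coef_fpsM /= -sumrMnl -big_split.
apply: eq_bigr => i _ /=; rewrite mulrnAl mulrnAr -mulrnDr subnKC //.
by rewrite -ltnS.
Qed.

Lemma fps_thetaX (A : comNzRingType) (f : fps A) m :
  fps_theta (f ^+ m.+1) = f ^+ m * fps_theta f *+ m.+1.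
Proof.
elim: m => [|m IHm]; first by rewrite expr1 expr0 mul1r.
by rewrite exprS fps_thetaM IHm mulrnAr mulrA -exprS [RHS]mulrS mulrC.
Qed.

Lemma coef_fps_exprN (A : comNzRingType) (f : fps A) m n :
  ((- f) ^+ m)`[n] = (-1) ^+ m * (f ^+ m)`[n].
Proof.
(* The two signs live in different rings, so both are reduced to the parity of [m]. *)
rewrite [in LHS]exprNn -(signr_odd (fps A)) -(signr_odd A).
by case: (odd m); rewrite ?expr1 ?expr0 ?mulN1r ?mul1r.
Qed.

(** * The series L = log (1 + t) and the powers (1 + t)^x *)

Section Log.
Variable A : comUnitRingType.
Hypothesis natU : forall n, n.+1%:R \is a @GRing.unit A.

Lemma factU n : n`!%:R \is a @GRing.unit A.
Proof. by rewrite -(prednK (fact_gt0 n)) natU. Qed.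

Local Notation L := (@log1t A).

(** This is L' = 1 / (1 + t), multiplied by [t] and cleared of its denominator. *)
Lemma theta_log1t : (1 + fps_t A) * fps_theta L = fps_t A.
Proof.
apply/fpsP => n; rewrite mulrDl mul1r coef_fpsD coef_fps_tM /=.
case: n => [|[|n]] /=; first by rewrite mulr0n addr0.
  by rewrite mulr0n addr0 divr1.
rewrite -[_ *+ n.+2]mulr_natr -[_ *+ n.+1]mulr_natr !mulrVK ?natU //.
by rewrite exprS mulN1r addNr.
Qed.

(** Coefficient of t^(n+1) in (1 + t) t d/dt L^(m+1) = (m + 1) t L^m. *)
Lemma coef_log1t_expr m n :
  (L ^+ m.+1)`[n.+1] *+ n.+1 + (L ^+ m.+1)`[n] *+ n = (L ^+ m)`[n] *+ m.+1.
Proof.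
have /fpsP/(_ n.+1) : (1 + fps_t A) * fps_theta (L ^+ m.+1) = fps_t A * (L ^+ m *+ m.+1).
  by rewrite fps_thetaX mulrnAr mulrCA theta_log1t mulrC -mulrnAr.
by rewrite mulrDl mul1r coef_fpsD !coef_fps_tM coef_fpsMn.
Qed.

(* Both sides satisfy (1 + t) f' = x f. *)
Lemma expxt_log1t x : fps_comp (expxt x) L = onetX x.
Proof.
apply/fpsP; elim=> [|n IHn]; first by rewrite /= big_ord1 !expr0 mulr1 big_ord0.
apply: (mulIr (natU n)); rewrite mulr_natr.
set E := fps_comp _ _ in IHn *.
have -> : E`[n.+1] *+ n.+1 = (x - n%:R) * E`[n].
  apply/eqP; rewrite mulrBl mulr_natl eq_sym subr_eq; apply/eqP.
  (* The sums on the right get one term more than the sum on the left: their head vanishes, and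
     their term of index [i + 1] matches the left term of index [i] by [coef_log1t_expr]. *)
  rewrite /E (@fps_compE _ _ _ n.+2 n.+1) //.
  rewrite [in RHS](@fps_compE _ _ _ n.+2 n) // (@fps_compE _ _ _ n.+1 n) //.
  rewrite -!sumrMnl -big_split [RHS]big_ord_recl /=.
  rewrite [X in _ = X + _](_ : _ = 0); last first.
    rewrite mulr0 mul0rn add0r.
    by case: n {E IHn} => // n; rewrite mulr0 mul0rn.
  rewrite add0r mulr_sumr; apply: eq_bigr => i _.
  rewrite /bump leq0n !add1n -!mulrnAr -mulrDr coef_log1t_expr -mulr_natr factS natrM.
  rewrite [in RHS]invrM ?natU ?factU // -[_`[n] *+ _]mulr_natl exprS -!mulrA.
  by rewrite mulKr ?natU // mul1r.
rewrite IHn /= factS natrM invrM ?natU ?factU // -[RHS]mulrA mulrVK ?natU //.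
by rewrite big_ord_recr /= mulrA; congr (_ / _); rewrite mulrC.
Qed.

Lemma expxtD (x y : A) : expxt (x + y) = expxt x * expxt y.
Proof.
apply/fpsP => n; rewrite coef_fpsM /= addrC exprDn mulr_suml.
apply: eq_bigr => i _; have le_in : (i <= n)%N by rewrite -ltnS.
have binV : 'C(n, i)%:R / n`!%:R = i`!%:R^-1 / (n - i)`!%:R :> A.
  apply: (mulIr (factU n)); rewrite mulrVK ?factU // -(bin_fact le_in) !natrM.
  by rewrite mulrCA mulrACA !mulVr ?factU // !mulr1.
by rewrite -[X in X / _]mulr_natr -[LHS]mulrA binV [X in X * _]mulrC mulrACA.
Qed.

(** Vandermonde's convolution, obtained by substituting L into the addition law of exp. *)
Lemma onetXD (x y : A) : onetX (x + y) = onetX x * onetX y.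
Proof. by rewrite -!expxt_log1t expxtD fps_compM. Qed.

Lemma onetX0 : onetX (0 : A) = 1.
Proof.
apply/fpsP => -[|n]; rewrite /= ?big_ord0 ?divr1 //.
by rewrite big_ord_recl subr0 !mul0r.
Qed.

Lemma onetXN (x : A) : onetX (- x) = (onetX x)^-1.
Proof.
have xV : onetX x * onetX (- x) = 1 by rewrite -onetXD subrr onetX0.
have Ux : onetX x \is a GRing.unit by apply/unitrPr; exists (onetX (- x)).
by apply: (mulrI Ux); rewrite xV mulrV.
Qed.

Lemma unit_onetX (x : A) : onetX x \is a GRing.unit.
Proof. by apply/unitrPr; exists (onetX (- x)); rewrite -onetXD subrr onetX0. Qed.

Lemma onetX_nat n : onetX (n%:R : A) = onetX 1 ^+ n.
Proof. by elim: n => [|n IHn]; rewrite ?onetX0 // exprS mulrS onetXD IHn. Qed.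

Lemma onetX1 : onetX (1 : A) = 1 + fps_t A.
Proof.
apply/fpsP => -[|[|n]]; rewrite coef_fpsD /=.
- by rewrite big_ord0 divr1 addr0.
- by rewrite big_ord1 subr0 divr1 add0r.
by rewrite !big_ord_recl /= subrr mul0r mulr0 mul0r addr0.
Qed.

(** * Substitution of - L and the factorization of the generating series *)

Lemma log1tN0 : (- L)`[0] = 0.
Proof. by rewrite coef_fpsN oppr0. Qed.

(** The sign of (- L)^i moves onto x^i, which gives (1 + t)^(- x). *)
Lemma fps_comp_expxt_log1tN x : fps_comp (expxt x) (- L) = (onetX x)^-1.
Proof.
rewrite -onetXN -expxt_log1t; apply/fpsP => n; apply: eq_bigr => i _ /=.
by rewrite coef_fps_exprN (exprNn x) !mulrA; congr (_ * _); rewrite mulrC mulrA.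
Qed.

Lemma unit_divt_log1t : fps_divt L \is a GRing.unit.
Proof. by rewrite unit_fpsE /= divr1 unitr1. Qed.

(** Substituting - L into t D = exp t - 1 gives - L D(- L) = - t / (1 + t); cancelling [t] yields (L
    / t) D(- L) = 1 / (1 + t), and D is then inverted. *)
Lemma fps_comp_t_over_expB1 :
  fps_comp t_over_expB1 (- L) = fps_divt L * onetX 1.
Proof.
pose D := fps_divt (expxt (1 : A) - 1).
have UD : D \is a GRing.unit by rewrite unit_fpsE /= expr1 divr1 subr0 unitr1.
have tD : fps_t A * D = expxt 1 - 1.
  by rewrite fps_divtK //= expr0 divr1 subrr.
have DL : fps_divt L * fps_comp D (- L) = (onetX 1)^-1.
  apply: fps_t_inj; rewrite mulrA fps_divtK //.
  have := congr1 (fun f => fps_comp f (- L)) tD.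
  rewrite fps_compM ?log1tN0 // fps_comp_t ?log1tN0 // fps_compD fps_compN fps_comp1.
  rewrite fps_comp_expxt_log1tN mulNr => /(congr1 -%R); rewrite opprK => ->.
  apply: (mulIr (unit_onetX 1)); rewrite mulrVK ?unit_onetX //.
  by rewrite mulNr mulrBl mulVr ?unit_onetX // mul1r onetX1 opprB addrC addKr.
have TD : fps_comp t_over_expB1 (- L) * fps_comp D (- L) = 1.
  by rewrite -fps_compM ?log1tN0 // mulVr // fps_comp1.
apply: (mulIr (unit_onetX (- 1))); rewrite onetXN mulrK ?unit_onetX // -DL.
by rewrite mulrCA TD mulr1.
Qed.

Lemma fps_comp_polyB_series x s :
  fps_comp (t_over_expB1 ^+ s * expxt x) (- L) =
    fps_divt L ^+ s * onetX s%:R / onetX x.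
Proof.
rewrite fps_compM ?log1tN0 // fps_compX ?log1tN0 // fps_comp_t_over_expB1.
by rewrite exprMn -onetX_nat fps_comp_expxt_log1tN.
Qed.

(** The powers (L / t)^s and (1 + t)^s from the first factor cancel against the shift of [r] by [s]
    and the division by (1 + t)^s. The series [c] stands for Lif_k(L). *)
Lemma polyA_series_factor (c : fps A) (r : int) x s :
  t_over_log ^ r * (c / onetX x) =
    fps_comp (t_over_expB1 ^+ s * expxt x) (- L) *
      (t_over_log ^ (r + s%:Z) * (c / onetX s%:R)).
Proof.
rewrite fps_comp_polyB_series.
have UT : (t_over_log : fps A) \is a GRing.unit by rewrite unitrV unit_divt_log1t.
rewrite exprzDr // -exprnP exprVn.
set T := t_over_log ^ r; set P := fps_divt _ ^+ s.
set O := onetX s%:R; set X := (onetX x)^-1.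
have UP : P \is a GRing.unit by rewrite unitrX ?unit_divt_log1t.
have UO : O \is a GRing.unit by apply: unit_onetX.
rewrite [T / P]mulrC [c / O]mulrC [P^-1 * T * _]mulrACA [P * O * X * _]mulrACA.
by rewrite [P * O * _]mulrACA !divrr // !mul1r mulrCA [X * c]mulrC.
Qed.

End Log.

(** * Compatibility of the classical series with ring morphisms *)

Section MapSeries.
Variables (A B : comUnitRingType) (phi : {rmorphism A -> B}).
Hypothesis natU : forall n, n.+1%:R \is a @GRing.unit A.

Lemma fps_map_log1t : fps_map phi log1t = log1t.
Proof.
apply/fpsP => -[|n] /=; first by rewrite rmorph0.
by rewrite rmorphM rmorphV ?natU // rmorph_nat rmorph_sign.
Qed.

Lemma fps_map_onetX x : fps_map phi (onetX x) = onetX (phi x).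
Proof.
apply/fpsP => n /=; rewrite rmorphM rmorphV ?factU // rmorph_nat rmorph_prod.
by congr (_ / _); apply: eq_bigr => i _; rewrite rmorphB rmorph_nat.
Qed.

Lemma fps_map_Lif k : fps_map phi (Lif k) = Lif k.
Proof.
apply/fpsP => n /=; have Un := factU natU n.
have Uk : (n.+1%:R ^ k : A) \is a GRing.unit by rewrite unitrXz.
by rewrite rmorphV ?unitrM ?Un // rmorphM rmorphXz ?natU // !rmorph_nat.
Qed.

Lemma fps_map_t_over_log : fps_map phi t_over_log = t_over_log.
Proof.
rewrite rmorphV ?unit_divt_log1t //; congr _^-1.
by have /fpsP eqL := fps_map_log1t; apply/fpsP => n; apply: eqL.
Qed.

(** Only the argument [x] is moved by [phi], so specializing [x] commutes with taking coefficients.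
    Inverses and integer powers are transported through the units [t_over_log] and [onetX x]. *)
Lemma fps_map_polyA_series r k x :
  fps_map phi (t_over_log ^ r * (fps_comp (Lif k) log1t / onetX x)) =
    t_over_log ^ r * (fps_comp (Lif k) log1t / onetX (phi x)).
Proof.
have eT : fps_map phi (t_over_log ^ r) = t_over_log ^ r.
  have UT : (t_over_log : fps A) \is a GRing.unit.
    by rewrite unitrV unit_divt_log1t.
  by rewrite -[in RHS]fps_map_t_over_log; apply: (rmorphXz (fps_map phi) r UT).
have eX : fps_map phi (onetX x)^-1 = (onetX (phi x))^-1.
  by rewrite -fps_map_onetX; apply: (rmorphV (fps_map phi) (unit_onetX natU x)).
have eC : fps_map phi (fps_comp (Lif k) log1t) = fps_comp (Lif k) log1t.
  by rewrite fps_map_comp fps_map_Lif fps_map_log1t.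
by rewrite -eT -eC -eX -!(rmorphM (fps_map phi)).
Qed.

End MapSeries.

(** * Stirling numbers and comparison of coefficients over F[x], in characteristic 0 *)

Section Char0.
Variable F : fieldType.
Hypothesis natU : forall n, n.+1%:R \is a @GRing.unit F.

Lemma poly_natU n : n.+1%:R \is a @GRing.unit {poly F}.
Proof. by rewrite -(rmorph_nat polyC) rmorph_unit ?natU. Qed.

Lemma polyC_factV n : n`!%:R^-1 = (n`!%:R^-1)%:P :> {poly F}.
Proof. by rewrite -polyCV rmorph_nat. Qed.

(** Powers of L are free of [x], so in exp (x L) the variable enters only through the coefficients
    of exp. *)
Lemma coef_log1t_expr_polyC m n :
  (log1t ^+ m : fps {poly F})`[n] = ((log1t ^+ m)`[n])%:P.
Proof. by rewrite -(fps_map_log1t polyC natU) -rmorphXn. Qed.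

(* Compare the coefficients of x^m t^n in (1 + t)^x = exp (x log (1 + t)). *)
Lemma stirling1_log1t m n :
  n`!%:R * (log1t ^+ m : fps F)`[n] = m`!%:R * (stirling1 n m)%:~R.
Proof.
have f0 k : k`!%:R != 0 :> F by rewrite -unitfE factU.
have /fpsP/(_ n)/(congr1 (fun p : {poly F} => p`_m)) := expxt_log1t poly_natU 'X.
have lt_m : (m < (maxn n m).+1)%N by rewrite ltnS leq_maxr.
(* The sum is prolonged up to [maxn n m] so that the index [m] occurs even when [m > n]; it is the
   only one contributing to x^m. *)
rewrite (@fps_compE _ _ _ (maxn n m).+1) ?ltnS ?leq_maxl // coef_sum.
rewrite (bigD1 (Ordinal lt_m)) //= big1 ?addr0 => [|i neq_im].
  rewrite coef_log1t_expr_polyC !polyC_factV coefMC coefMC coefXn eqxx mul1r coefMC.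
  have -> : (\prod_(i < n) ('X - i%:R) : {poly F})`_m = (stirling1 n m)%:~R.
    rewrite /stirling1 -coef_map rmorph_prod /=; congr (polyseq _)`_m.
    by apply: eq_bigr => i _; rewrite rmorphB /= map_polyX rmorph_nat.
  move=> eqS; rewrite -[X in _ * X](mulVKf (f0 m)).
  by rewrite mulrCA; congr (_ * _); rewrite eqS mulrCA mulfV ?mulr1.
rewrite coef_log1t_expr_polyC polyC_factV !coefMC coefXn.
by rewrite (_ : m == i = false) ?mul0r //; apply: contra_neqF neq_im => /eqP mi; apply/val_inj.
Qed.

Lemma stirling1_gt m n : (n < m)%N -> stirling1 n m = 0.
Proof.
move=> lt_nm; rewrite /stirling1 nth_default //; apply: leq_trans lt_nm.
elim: {m} n => [|n IHn]; first by rewrite big_ord0 size_poly1.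
rewrite big_ord_recr /=.
have -> : n%:R = (n%:R)%:P :> {poly int} by rewrite rmorph_nat.
by rewrite (leq_trans (size_polyMleq _ _)) // size_XsubC addn2.
Qed.

(** Evaluation at [x] followed by [polyC] is an endomorphism of F[x]; the values thus stay in the
    ring over which the generating series of the sum formula are multiplied. *)
Lemma polyA_horner l r k x :
  ((polyA F l r k).[x])%:P =
    l`!%:R * (t_over_log ^ r * (fps_comp (Lif k) log1t / onetX x%:P))`[l].
Proof.
pose phi : {rmorphism {poly F} -> {poly F}} := polyC \o horner_eval x.
have phiX : phi 'X = x%:P by rewrite /= /horner_eval hornerX.
rewrite -[LHS]/(phi (polyA F l r k)) rmorphM rmorph_nat; congr (_ * _).
rewrite -[LHS]/((fps_map phi _)`[l]); congr _`[l].
by rewrite fps_map_polyA_series ?phiX //; apply: poly_natU.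
Qed.

Lemma polyA_sum_polyB (n s : nat) (r k : int) :
  polyA F n r k =
    \sum_(m < n.+1)
      ((-1) ^+ m *
       \sum_(l < (n - m).+1)
         'C(n, l)%:R * (stirling1 (n - l) m)%:~R *
         (polyA F l (r + s%:Z) k).[s%:R])
      *: polyB F m s.
Proof.
pose a : fps {poly F} :=
  t_over_log ^ (r + s%:Z) * (fps_comp (Lif k) log1t / onetX s%:R).
pose b : fps {poly F} := t_over_expB1 ^+ s * expxt 'X.
have Up := poly_natU.
(* The bookkeeping of one term: [c] is the binomial, [fl], [fk], [fm] are the factorials of [l],
   [n - l], [m], [x] and [y] are coefficients of [b] and [a], [e] is the sign, and [p], [q] are the
   coefficient of L^m and the Stirling number. *)
have ringE (S : comNzRingType) (c fl fk fm x y e p q : S) : fk * p = fm * q ->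
    c * (fl * fk) * (x * (y * (e * p))) = e * (c * q * (fl * y)) * (fm * x).
  move=> eq_pq; transitivity (c * fl * x * y * e * (fk * p)); first by ring.
  by rewrite eq_pq; ring.
have -> : polyA F n r k = n`!%:R * (fps_comp b (- log1t) * a)`[n].
  by congr (_ * _`[n]); apply: polyA_series_factor.
rewrite fps_comp_mulE ?log1tN0 // mulr_sumr; apply: eq_bigr => m _.
rewrite -mul_polyC rmorphM rmorph_sign.
pose H l := 'C(n, l)%:R * (stirling1 (n - l) m)%:~R * (polyA F l (r + s%:Z) k).[s%:R].
(* For [l > n - m] the Stirling number vanishes, so the range can be that of the Cauchy product. *)
have -> : \sum_(l < (n - m).+1) H l = \sum_(l < n.+1) H l.
  rewrite (big_ord_widen n.+1 H) ?ltnS ?leq_subr //.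
  rewrite [RHS](bigID (fun l : 'I_n.+1 => l < (n - m).+1)%N) /=.
  rewrite [X in _ = _ + X]big1 ?addr0 // => l; rewrite -leqNgt => lt_l.
  by rewrite /H stirling1_gt ?mulr0 ?mul0r // ltn_subLR 1?addnC -?ltn_subLR // -ltnS.
rewrite rmorph_sum [_ ^+ m * a]mulrC coef_fpsM !mulr_sumr mulr_suml.
apply: eq_bigr => l _.
have le_ln : (l <= n)%N by rewrite -ltnS.
rewrite -[X in _ * X * _]/((H l)%:P) coef_fps_exprN.
have -> : (H l)%:P = 'C(n, l)%:R * ((stirling1 (n - l) m)%:~R)%:P * (l`!%:R * a`[l]).
  by rewrite /H !polyCM polyA_horner !rmorph_nat.
have := congr1 polyC (stirling1_log1t m (n - l)).
rewrite !polyCM -coef_log1t_expr_polyC !rmorph_nat => eqS.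
rewrite -(bin_fact le_ln) !natrM -[polyB F m s]/(m`!%:R * b`[m]).
exact: ringE eqS.
Qed.

End Char0.

Theorem theorem2p6 (R : realType) (n s : nat) (r k : int) :
  polyA R[i] n r k =
    \sum_(m < n.+1)
      ((-1) ^+ m *
       \sum_(l < (n - m).+1)
         'C(n, l)%:R * (stirling1 (n - l) m)%:~R *
         (polyA R[i] l (r + s%:Z) k).[s%:R])
      *: polyB R[i] m s.
Proof.
by apply: polyA_sum_polyB => m; rewrite unitfE Num.Theory.pnatr_eq0.
Qed.
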